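(* The first uncountable ordinal $\omega_1$ is transcendental, that is, with the Nim operations the set $\omega_1$ of all countable ordinals is an algebraically closed field.
   Context: $\oplus$ and $\otimes$ denote Nim-sum and Nim-product of ordinals, defined recursively by $\alpha \oplus \beta = \operatorname{mex}\{\alpha' \oplus \beta, \alpha \oplus \beta' \mid \alpha'<\alpha, \beta'<\beta\}$ and $\alpha \otimes \beta = \operatorname{mex}\{(\alpha' \otimes \beta) \oplus (\alpha \otimes \beta') \oplus (\alpha' \otimes \beta') \mid \alpha'<\alpha, \beta'<\beta\}$, where $\operatorname{mex}(S)$ is the least ordinal not in $S$. With these operations the class of ordinals is a Field of characteristic 2, denoted $\mathrm{On}_2$. An ordinal is identified with the set of smaller ordinals. An ordinal is called transcendental if it is an algebraically closed subfield of $\mathrm{On}_2$. *)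

(* Defs.v *)
From HB Require Import structures.
From mathcomp Require Import all_boot all_order all_algebra.
From mathcomp Require Import boolp classical_sets functions cardinality.

Set Implicit Arguments.
Unset Strict Implicit.
Unset Printing Implicit Defensive.

Import Order.TTheory.
Local Open Scope classical_set_scope.
Local Open Scope order_scope.
Local Open Scope quotient_scope.

(* [Sup A f] codes the least ordinal strictly above all the ordinals [f a].   *)
(* Every ordinal has such codes, and ordinals are codes up to [tle]-          *)
(* equivalence.  The class of all ordinals is thus rendered as a type whose   *)
(* "sets" are the families indexed by types of a fixed smaller universe.      *)
Inductive tree : Type := Sup (A : Type) (f : A -> tree).

Fixpoint tle (s t : tree) : Prop :=
  match s, t with
  | Sup A f, Sup B g => forall a : A, exists b : B, tle (f a) (g b)
  end.

Definition tlt (s t : tree) : Prop :=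
  match t with Sup B g => exists b : B, tle s (g b) end.

Lemma tle_refl s : tle s s.
Proof. by elim: s => A f IH /= a; exists a. Qed.

Lemma tle_trans s t u : tle s t -> tle t u -> tle s u.
Proof.
elim: s t u => A f IH [B g] [C h] /= st tu a.
by have [b ab] := st a; have [c bc] := tu b; exists c; apply: IH ab bc.
Qed.

Lemma tlt_le_trans s t u : tlt s t -> tle t u -> tlt s u.
Proof.
case: t u => B g [C h] /= [b sb] tu; have [c bc] := tu b.
by exists c; apply: tle_trans bc.
Qed.

Lemma tltNge s t : tlt t s <-> ~ tle s t.
Proof.
split.
  elim: s t => A f IH t /= [a ta] st.
  apply: (IH a (f a)); last exact: tle_refl.
  apply: tlt_le_trans ta.
  by case: t st => B g /(_ a).
elim: s t => A f IH [B g] /= /existsNP[a Na]; exists a.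
have {}Na b : tlt (g b) (f a) by apply: IH => ab; apply: Na; exists b.
by case: (f a) Na.
Qed.

Lemma tltW s t : tlt s t -> tle s t.
Proof.
elim: s t => A f IH [B g] [b sb] a; exists b.
by apply: tle_trans sb; apply: IH; exists a; apply: tle_refl.
Qed.

Lemma tlt_wf : well_founded tlt.
Proof.
suff H s t : tle t s -> Acc tlt t by move=> s; apply: (H s); apply: tle_refl.
elim: s t => A f IH t ts; constructor=> u ut.
by have [a ua] := tlt_le_trans ut ts; apply: IH ua.
Qed.

HB.instance Definition _ := gen_eqMixin tree.
HB.instance Definition _ := gen_choiceMixin tree.

Definition teq (s t : tree) : bool := `[< tle s t /\ tle t s >].

Lemma teq_refl : reflexive teq.
Proof. by move=> s; apply/asboolP; split; apply: tle_refl. Qed.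

Lemma teq_sym : symmetric teq.
Proof. by move=> s t; apply/asboolP/asboolP => -[]. Qed.

Lemma teq_trans : transitive teq.
Proof.
move=> t s u /asboolP[st ts] /asboolP[tu ut]; apply/asboolP.
by split; [apply: tle_trans tu|apply: tle_trans ts].
Qed.

Canonical teq_equiv := EquivRel teq teq_refl teq_sym teq_trans.

Definition On : Type := {eq_quot teq}.

HB.instance Definition _ := Choice.on On.
HB.instance Definition _ := Quotient.on On.

Definition On_le (x y : On) : bool := `[< tle (repr x) (repr y) >].

Fact On_display : Order.disp_t. Proof. exact: (Order.Disp tt tt). Qed.

Lemma On_le_refl : reflexive On_le.
Proof. by move=> x; apply/asboolP/tle_refl. Qed.

Lemma On_le_anti : antisymmetric On_le.
Proof.
move=> x y /andP[/asboolP xy /asboolP yx].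
by rewrite -[x]reprK -[y]reprK; apply/eqmodP/asboolP.
Qed.

Lemma On_le_trans : transitive On_le.
Proof. by move=> y x z /asboolP xy /asboolP yz; apply/asboolP/(tle_trans xy). Qed.

HB.instance Definition _ := Order.Le_isPOrder.Build On_display On
  On_le_refl On_le_anti On_le_trans.

Lemma On_le_total : total (<=%O : rel On).
Proof.
move=> x y; case: (boolP (x <= y)) => //= /asboolP/tltNge/tltW yx.
exact/asboolP.
Qed.

HB.instance Definition _ :=
  Order.POrder_isTotal.Build On_display On On_le_total.

Lemma On_leE s t : (\pi_On s <= \pi_On t) = `[< tle s t >].
Proof.
have eqr u : tle u (repr (\pi_On u)) /\ tle (repr (\pi_On u)) u.
  apply/asboolP; suff: u = repr (\pi_On u) %[mod_eq teq] by move=> /eqmodP.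
  by rewrite reprK.
have [[s1 s2] [t1 t2]] := (eqr s, eqr t).
apply/asboolP/asboolP => st.
  by apply: tle_trans s1 (tle_trans st t2).
by apply: tle_trans s2 (tle_trans st t1).
Qed.

Lemma On_ltE s t : (\pi_On s < \pi_On t) = `[< tlt s t >].
Proof.
rewrite ltNge On_leE -asbool_neg; congr asbool.
by apply/propext; split=> /tltNge.
Qed.

Lemma On_wf : well_founded (fun x y : On => x < y).
Proof.
suff H s : Acc (fun x y : On => x < y) (\pi_On s).
  by move=> x; rewrite -[x]reprK.
elim/(well_founded_ind tlt_wf): s => s IH; constructor=> y.
by rewrite -[y]reprK On_ltE => /asboolP; apply: IH.
Qed.

Definition On_zero : On :=
  \pi_On (Sup (fun v : void => match v with end)).

Definition least (P : set On) : On :=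
  xget On_zero [set x | P x /\ forall y, P y -> x <= y].

Lemma leastP (P : set On) :
  P !=set0 -> P (least P) /\ forall y, P y -> least P <= y.
Proof.
move=> [z Pz]; rewrite /least; case: xgetP => [x _ [] //|none]; exfalso.
elim/(well_founded_ind On_wf): z Pz => z IH Pz; apply: (none z); split=> // y Py.
by rewrite leNgt; apply/negP => /IH; apply.
Qed.

(* A predicate on [On] may be a proper class; [small] ones are sets. *)
Definition small (S : set On) : Prop :=
  exists (A : Type) (g : A -> tree), S `<=` range (fun a => \pi_On (g a)).

Lemma small_bounded S : small S -> exists z : On, forall y, S y -> y < z.
Proof.
move=> [A [g Sg]]; exists (\pi_On (Sup g)) => y /Sg[a _ <-].
by rewrite On_ltE; apply/asboolP; exists a; apply: tle_refl.
Qed.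

Lemma small_image2 (S T : set On) (f : On -> On -> On) :
  small S -> small T -> small [set f x y | x in S & y in T].
Proof.
move=> [A [g Sg]] [B [h Th]].
exists (A * B)%type, (fun p => repr (f (\pi_On (g p.1)) (\pi_On (h p.2)))).
move=> _ [x /Sg[a _ <-] [y /Th[b _ <-] <-]].
by exists (a, b) => //=; rewrite reprK.
Qed.

Lemma small_image (S : set On) (f : On -> On) : small S -> small (f @` S).
Proof.
move=> [A [g Sg]]; exists A, (fun a => repr (f (\pi_On (g a)))).
by move=> _ [x /Sg[a _ <-] <-]; exists a => //=; rewrite reprK.
Qed.

Lemma small_setU (S T : set On) : small S -> small T -> small (S `|` T).
Proof.
move=> [A [g Sg]] [B [h Th]].
exists (A + B)%type, (fun p => match p with inl a => g a | inr b => h b end).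
by move=> x [/Sg[a _ <-]|/Th[b _ <-]]; [exists (inl a)|exists (inr b)].
Qed.

Fixpoint below (t : tree) : Type :=
  match t with Sup A f => {a : A & option (below (f a))} end.

Fixpoint below_tree (t : tree) : below t -> tree :=
  match t with
  | Sup A f => fun p : {a : A & option (below (f a))} =>
      match p with
      | existT a None => f a
      | existT a (Some q) => below_tree q
      end
  end.

Lemma below_treeP s t : tlt s t -> exists p : below t, teq s (below_tree p).
Proof.
elim: t => A f IH /= [a sa]; case: (pselect (tle (f a) s)) => [as_|/tltNge sl].
  by exists (existT _ a None); apply/asboolP.
by have [q sq] := IH _ sl; exists (existT _ a (Some q)).
Qed.

Lemma small_lt a : small [set x | x < a].
Proof.
exists (below (repr a)), (@below_tree (repr a)) => x /= xa.
have /below_treeP[p xp] : tlt (repr x) (repr a).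
  by apply/asboolP; rewrite -On_ltE !reprK.
by exists p => //; rewrite -[x]reprK; apply/esym/eqmodP.
Qed.

(* The least ordinal not in [S], for small [S]. *)
Definition mex (S : set On) : On := least (~` S).

Lemma mexP S : small S -> ~ S (mex S) /\ forall y, y < mex S -> S y.
Proof.
move=> /small_bounded[z Sz].
have [|nS minS] := @leastP (~` S); first by exists z => /Sz; rewrite ltxx.
by split=> // y yS; apply: contrapT => /minS; rewrite leNgt yS.
Qed.

Definition On_rec2
    (F : forall a b : On,
      (forall a', a' < a -> On -> On) -> (forall b', b' < b -> On) -> On) :
    On -> On -> On :=
  Fix On_wf (fun _ => On -> On) (fun a recl =>
    Fix On_wf (fun _ => On) (fun b recr => F a b recl recr)).

Lemma On_rec2E F a b : On_rec2 F a b =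
  F a b (fun a' _ => On_rec2 F a') (fun b' _ => On_rec2 F a b').
Proof.
have FixE (P : On -> Type) (G : forall x, (forall y, y < x -> P y) -> P x) x :
    Fix On_wf P G x = G x (fun y _ => Fix On_wf P G y).
  apply: Fix_eq => y f g fg; congr (G y).
  by apply: functional_extensionality_dep => z;
     apply: functional_extensionality_dep => l.
have rec1E c : On_rec2 F c = Fix On_wf (fun _ => On)
    (fun d recr => F c d (fun a' _ => On_rec2 F a') recr).
  by rewrite /On_rec2 FixE.
rewrite {1}rec1E FixE; congr (F a b _ _).
by apply: functional_extensionality_dep => b';
   apply: functional_extensionality_dep => l; rewrite rec1E.
Qed.

Definition nim_add : On -> On -> On :=
  On_rec2 (fun a b recl recr =>
    mex ([set z | exists a' (la : a' < a), recl a' la b = z] `|`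
         [set z | exists b' (lb : b' < b), recr b' lb = z])).

Declare Scope nim_scope.
Delimit Scope nim_scope with nim.
Local Open Scope nim_scope.
Notation "a ⊕ b" := (nim_add a b) (at level 50, left associativity) : nim_scope.

Lemma nim_addE a b :
  a ⊕ b = mex ([set a' ⊕ b | a' in [set x | x < a]] `|`
               [set a ⊕ b' | b' in [set y | y < b]]).
Proof.
rewrite {1}/nim_add On_rec2E; congr (mex (_ `|` _)).
  by apply/seteqP; split=> z; [move=> [a' [la <-]]; exists a'|
                               move=> [a' la <-]; exists a', la].
by apply/seteqP; split=> z; [move=> [b' [lb <-]]; exists b'|
                             move=> [b' lb <-]; exists b', lb].
Qed.

Definition nim_mul : On -> On -> On :=
  On_rec2 (fun a b recl recr =>
    mex [set z | exists a' (la : a' < a) b' (lb : b' < b),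
           recl a' la b ⊕ recr b' lb ⊕ recl a' la b' = z]).

Notation "a ⊗ b" := (nim_mul a b) (at level 40, left associativity) : nim_scope.

Lemma nim_mulE a b :
  a ⊗ b = mex [set (a' ⊗ b) ⊕ (a ⊗ b') ⊕ (a' ⊗ b')
              | a' in [set x | x < a] & b' in [set y | y < b]].
Proof.
rewrite {1}/nim_mul On_rec2E; congr mex; apply/seteqP; split=> z.
  by move=> [a' [la [b' [lb <-]]]]; exists a' => //; exists b'.
by move=> [a' la [b' lb <-]]; exists a', la, b', lb.
Qed.

(* Both mex's above are taken over small sets. *)
Lemma nim_addP a b :
  (forall a', a' < a -> a ⊕ b <> a' ⊕ b) /\
  (forall b', b' < b -> a ⊕ b <> a ⊕ b') /\
  forall z, z < a ⊕ b ->
    (exists2 a', a' < a & a' ⊕ b = z) \/ (exists2 b', b' < b & a ⊕ b' = z).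
Proof.
rewrite nim_addE; have [] := mexP (small_setU
  (small_image (nim_add^~ b) (small_lt a)) (small_image (nim_add a) (small_lt b))).
set S := (X in mex X) => nS ltS; split; last split=> [|z /ltS//].
  by move=> a' la e; apply: nS; left; exists a'.
by move=> b' lb e; apply: nS; right; exists b'.
Qed.

Lemma nim_mulP a b :
  (forall a' b', a' < a -> b' < b -> a ⊗ b <> a' ⊗ b ⊕ a ⊗ b' ⊕ a' ⊗ b') /\
  forall z, z < a ⊗ b ->
    exists2 a', a' < a & exists2 b', b' < b &
      a' ⊗ b ⊕ a ⊗ b' ⊕ a' ⊗ b' = z.
Proof.
rewrite nim_mulE; have [] := mexP (small_image2
  (fun a' b' => a' ⊗ b ⊕ a ⊗ b' ⊕ a' ⊗ b') (small_lt a) (small_lt b)).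
set S := (X in mex X) => nS ltS; split=> [|z /ltS//].
by move=> a' b' la lb e; apply: nS; exists a' => //; exists b'.
Qed.

Definition omega1 : On := least [set a | ~ countable [set x | x < a]].

Lemma On_uncountable : exists a : On, ~ countable [set x | x < a].
Proof.
pose W := {R : nat -> nat -> bool | well_founded (fun m n => R m n)}.
pose rk (w : W) : nat -> tree := Fix (proj2_sig w) (fun _ => tree)
  (fun n rec => Sup (fun p : {m | proj1_sig w m n} =>
     rec (proj1_sig p) (proj2_sig p))).
have rkE w n : rk w n =
    Sup (fun p : {m | proj1_sig w m n} => rk w (proj1_sig p)).
  rewrite /rk Fix_eq // => m f g fg; congr (@Sup _ _).
  by apply: functional_extensionality_dep => -[k l] /=; apply: fg.
pose S : set On := range (fun w => \pi_On (Sup (rk w))).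
have /small_bounded[z Sz] : small S by exists W, (fun w => Sup (rk w)).
exists z => /countable_injP[h hinj].
have {}hinj x y : x < z -> y < z -> h x = h y -> x = y.
  by move=> xz yz; apply: hinj; rewrite inE.
pose R m n := `[< exists x y, [/\ x < y, y < z, h x = m & h y = n] >].
have RE x y : x < y -> y < z -> R (h x) (h y).
  by move=> xy yz; apply/asboolP; exists x, y.
have wfR : well_founded (fun m n => R m n).
  have accR y : y < z -> Acc (fun m n => R m n) (h y).
    elim/(well_founded_ind On_wf): y => y IH yz; constructor=> m.
    move=> /asboolP[x [y' [xy' y'z <- /hinj eqy]]].
    by apply: IH; [rewrite -eqy|apply: lt_trans xy' y'z].
  move=> n; constructor=> m /asboolP[x [y [xy yz <- _]]].
  exact/accR/(lt_trans xy).
pose w : W := exist _ R wfR.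
have le_rk x : x < z -> x <= \pi_On (rk w (h x)).
  elim/(well_founded_ind On_wf): x => x IH xz; rewrite leNgt; apply/negP => ux.
  have uz := lt_trans ux xz; have := IH _ ux uz; set u := \pi_On _ in ux uz *.
  rewrite leNgt => /negP; apply; rewrite /u On_ltE; apply/asboolP.
  rewrite [X in tlt _ X]rkE; exists (exist _ (h u) (RE _ _ ux xz)).
  exact: tle_refl.
have yz : \pi_On (Sup (rk w)) < z by apply: Sz; exists w.
have := le_rk _ yz; set y := \pi_On (Sup _).
rewrite leNgt => /negP; apply; rewrite On_ltE; apply/asboolP.
by exists (h y); apply: tle_refl.
Qed.

Lemma omega1P : ~ countable [set x | x < omega1] /\
  forall a, a < omega1 -> countable [set x | x < a].
Proof.
have [nc min] := leastP (P := [set a | ~ countable [set x | x < a]]) On_uncountable.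
split=> // a a_lt; apply: contrapT => /min.
by rewrite leNgt a_lt.
Qed.

(* A subset of a field closed under the operations is a subfield exactly when *)
(* it is a field for the induced operations, whence the absence of clauses on *)
(* 0, 1, opposites and inverses: [f] identifies [F] with the set of ordinals  *)
(* below [a] equipped with the Nim operations.                                *)
Definition transcendental (a : On) : Prop :=
  exists (F : closedFieldType) (f : F -> On),
    [/\ injective f, range f = [set x | x < a],
        {morph f : x y / (x + y)%R >-> x ⊕ y} &
        {morph f : x y / (x * y)%R >-> x ⊗ y}].

(* Main.v *)
(** By the mex rule, every z < a ⊗ b has the form a b - (a - a')(b - b') with
    a' < a and b' < b; by induction, every z < a^n has the form
    a^n - (a - c_1)...(a - c_n) with all c_i < a.  It follows that if the
    ordinals below g form a ring, then the values p(g) of the polynomials p of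
    size at most k over this ring form an initial segment of the ordinals.

    Let X^n - q be a monic polynomial with countable coefficients.  Since a
    countable ring has countably many algebraic elements, iterating omega times
    yields a countable g above these coefficients such that the ordinals below
    g form a ring over which no countable ordinal >= g is algebraic; in
    particular g itself is transcendental over it.  If g^n <= q(g), then
    g^n = r(g) for some r of size at most n, against transcendence.  If
    q(g) < g^n, then q(g) = g^n - (g - c_1)...(g - c_n), so by transcendence
    X^n - q = (X - c_1)...(X - c_n) has the root c_1 < g.  Inverses are
    obtained in the same way, by comparing a ⊗ g with 1. *)

Require Import Defs.
From HB Require Import structures.
From mathcomp Require Import all_boot all_order all_algebra all_field.
From mathcomp Require Import boolp classical_sets functions cardinality ring.

Set Implicit Arguments.
Unset Strict Implicit.
Unset Printing Implicit Defensive.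

Import Order.TTheory GRing.Theory.
Local Open Scope classical_set_scope.
Local Open Scope ring_scope.
Local Open Scope order_scope.
Local Open Scope nim_scope.

(** * Order of the ordinals *)

Definition On_ind := well_founded_ind On_wf.

Lemma On_ge0 (x : On) : On_zero <= x.
Proof. by rewrite -[x]reprK On_leE; apply/asboolP; case: (repr x) => A f []. Qed.

Lemma On_lt0 (x : On) : (x < On_zero) = false.
Proof. by rewrite ltNge On_ge0. Qed.

Lemma On_gt0 (x : On) : (On_zero < x) = (x != On_zero).
Proof. by rewrite lt_neqAle On_ge0 andbT eq_sym. Qed.

(** Scheme of the ring identities below: a value smaller than a mex is one of its options, and
    induction turns it into an option of the other side, which that side cannot equal. *)
Lemma On_eq_nlt (x y : On) : ~ x < y -> ~ y < x -> x = y.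
Proof. by case: (ltgtP x y). Qed.

(** * The ring of ordinals *)

Lemma nim_addC : commutative nim_add.
Proof.
elim/On_ind=> a IHa; elim/On_ind=> b IHb.
have [addN [addNr _]] := nim_addP a b; have [baN [baNr _]] := nim_addP b a.
apply: On_eq_nlt.
  move=> /(nim_addP b a).2.2[[b' lb]|[a' la]].
    by rewrite -IHb // => /esym; apply: addNr.
  by rewrite -IHa // => /esym; apply: addN.
move=> /(nim_addP a b).2.2[[a' la]|[b' lb]].
  by rewrite IHa // => /esym; apply: baNr.
by rewrite IHb // => /esym; apply: baN.
Qed.

Lemma nim_addIr b : injective (nim_add^~ b).
Proof.
move=> a a' /= e; case: (ltgtP a a') => // lt; exfalso.
  exact: (nim_addP a' b).1 lt (esym e).
exact: (nim_addP a b).1 lt e.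
Qed.

Lemma nim_addIl a : injective (nim_add a).
Proof. by move=> b b'; rewrite ![a ⊕ _]nim_addC; apply: nim_addIr. Qed.

Lemma nim_add0 : left_id On_zero nim_add.
Proof.
elim/On_ind=> a IH; apply: On_eq_nlt => lt.
  by have := IH _ lt => /nim_addIl e; rewrite e ltxx in lt.
have [_ [_ /(_ _ lt)[[z]|[a' la]]]] := nim_addP On_zero a.
  by rewrite On_lt0.
by rewrite IH // => e; rewrite e ltxx in la.
Qed.

Lemma nim_addxx : left_inverse On_zero id nim_add.
Proof.
elim/On_ind=> a IH; apply/eqP; rewrite -[_ == _]negbK -On_gt0; apply/negP.
move=> /(nim_addP a a).2.2[[a' la]|[a' la]]; rewrite -(IH _ la).
  by move/nim_addIl=> e; rewrite e ltxx in la.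
by move/nim_addIr=> e; rewrite e ltxx in la.
Qed.

Lemma nim_addA : associative nim_add.
Proof.
elim/On_ind=> a IHa; elim/On_ind=> b IHb; elim/On_ind=> c IHc.
apply: On_eq_nlt.
  move=> /(nim_addP (a ⊕ b) c).2.2[[d ld]|[c' lc]]; last first.
    by rewrite -IHc // => /nim_addIl/nim_addIl e; rewrite e ltxx in lc.
  have [[a' la <-]|[b' lb <-]] := (nim_addP a b).2.2 _ ld.
    by rewrite -IHa // => /nim_addIr e; rewrite e ltxx in la.
  by rewrite -IHb // => /nim_addIl/nim_addIr e; rewrite e ltxx in lb.
move=> /(nim_addP a (b ⊕ c)).2.2[[a' la]|[d ld]].
  by rewrite IHa // => /nim_addIr/nim_addIr e; rewrite e ltxx in la.
have [[b' lb <-]|[c' lc <-]] := (nim_addP b c).2.2 _ ld.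
  by rewrite IHb // => /nim_addIr/nim_addIl e; rewrite e ltxx in lb.
by rewrite IHc // => /nim_addIl e; rewrite e ltxx in lc.
Qed.

HB.instance Definition _ :=
  GRing.isZmodule.Build On nim_addA nim_addC nim_add0 nim_addxx.

Lemma oppOn (a : On) : (- a)%R = a.
Proof. by []. Qed.

Lemma addOn_eq0 (a b : On) : (a + b == 0)%R = (a == b).
Proof. by rewrite addr_eq0 oppOn. Qed.

Lemma addOnxx (a : On) : (a + a = 0)%R.
Proof. exact: nim_addxx. Qed.

Lemma addOn_eq (a b : On) : (a + b = 0)%R -> a = b.
Proof. by move/eqP; rewrite addOn_eq0 => /eqP. Qed.

Lemma ltOn_add (z a b : On) : z < (a + b)%R ->
  (exists2 a', a' < a & z = (a' + b)%R) \/ (exists2 b', b' < b & z = (a + b')%R).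
Proof.
move=> /(nim_addP a b).2.2[[a' la <-]|[b' lb <-]].
  by left; exists a'.
by right; exists b'.
Qed.

(* This is a ⊗ b - (a - a') ⊗ (b - b') expanded in characteristic 2. *)
Definition mex_term (a b a' b' : On) : On :=
  (a' ⊗ b + a ⊗ b' + a' ⊗ b')%R.

Lemma ltOn_mex_term (z a b : On) : z < a ⊗ b ->
  exists2 a', a' < a & exists2 b', b' < b & z = mex_term a b a' b'.
Proof.
move=> /(nim_mulP a b).2[a' la [b' lb <-]].
by exists a' => //; exists b'.
Qed.

(** The sum [D] of the four products is unchanged when a and a', or b and b', are exchanged, so one
    may assume a' < a and b' < b, where the mex excludes equality. Larger a' and b' do occur: b' < b
    does not give b' + c < b + c. *)
Lemma mex_term_neq (a b a' b' : On) :
  a' != a -> b' != b -> a ⊗ b <> mex_term a b a' b'.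
Proof.
pose D a b a' b' : On := (a ⊗ b + mex_term a b a' b')%R.
have DCl a1 b1 a2 b2 : D a1 b1 a2 b2 = D a2 b1 a1 b2.
  by rewrite /D /mex_term !addrA [RHS](ACl (2*1*4*3))%AC.
have DCr a1 b1 a2 b2 : D a1 b1 a2 b2 = D a1 b2 a2 b1.
  by rewrite /D /mex_term !addrA [RHS](ACl (3*4*1*2))%AC.
have ltD a1 b1 a2 b2 : a2 < a1 -> b2 < b1 -> D a1 b1 a2 b2 <> 0%R.
  by move=> la lb /addOn_eq; apply: (nim_mulP a1 b1).1.
suff neqD : a' != a -> b' != b -> D a b a' b' <> 0%R.
  by move=> na nb e; apply: neqD => //; rewrite /D e addOnxx.
case: (ltgtP a' a) => // la _; case: (ltgtP b' b) => // lb _.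
- exact: ltD.
- by rewrite DCr; apply: ltD.
- by rewrite DCl; apply: ltD.
- by rewrite DCl DCr; apply: ltD.
Qed.

Lemma nim_mulC : commutative nim_mul.
Proof.
elim/On_ind=> a IHa; elim/On_ind=> b IHb.
have mexC a' b' : a' < a -> b' < b -> mex_term a b a' b' = mex_term b a b' a'.
  move=> la lb; rewrite /mex_term (IHa a') // (IHb b') // (IHa a') //.
  by rewrite [(b ⊗ a' + _)%R]addrC.
apply: On_eq_nlt => lt.
  have [b' lb [a' la]] := ltOn_mex_term lt.
  by rewrite -mexC // => /mex_term_neq []; rewrite lt_eqF.
have [a' la [b' lb]] := ltOn_mex_term lt.
by rewrite mexC // => /mex_term_neq []; rewrite lt_eqF.
Qed.

Lemma nim_mul0 a : On_zero ⊗ a = On_zero.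
Proof.
apply/eqP; rewrite -[_ == _]negbK -On_gt0; apply/negP => lt.
by have [a'] := ltOn_mex_term lt; rewrite On_lt0.
Qed.

Lemma nim_mulDr : right_distributive nim_mul (+%R : On -> On -> On).
Proof.
elim/On_ind=> a IHa; elim/On_ind=> b IHb; elim/On_ind=> c IHc.
(* Options of a ⊗ b translated by a ⊗ c are options of a ⊗ (b + c), because a' ⊗ c occurs twice and
   cancels. *)
have mexDl a' b' : a' < a -> b' < b ->
    mex_term a (b + c)%R a' (b' + c)%R = (mex_term a b a' b' + a ⊗ c)%R.
  move=> la lb; rewrite /mex_term !(IHa a') // IHb // !addrA.
  by rewrite [LHS](ACl (1*3*5*4*(2*6)))%AC /= addOnxx addr0.
have mexDr a' c' : a' < a -> c' < c ->
    mex_term a (b + c)%R a' (b + c')%R = (a ⊗ b + mex_term a c a' c')%R.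
  move=> la lc; rewrite /mex_term !(IHa a') // IHc // !addrA.
  by rewrite [LHS](ACl (3*2*4*6*(1*5)))%AC /= addOnxx addr0.
have ltDl b' : b' < b -> (b' + c)%R != (b + c)%R.
  by move=> lb; rewrite (inj_eq (addIr c)) lt_eqF.
have ltDr c' : c' < c -> (b + c')%R != (b + c)%R.
  by move=> lc; rewrite (inj_eq (addrI b)) lt_eqF.
apply: On_eq_nlt => lt.
  have [[z lz]|[z lz]] := ltOn_add lt; have [a' la [x' lx ->]] := ltOn_mex_term lz.
    by rewrite -mexDl // => /mex_term_neq []; rewrite ?ltDl ?lt_eqF.
  by rewrite -mexDr // => /mex_term_neq []; rewrite ?ltDr ?lt_eqF.
have [a' la [d ld]] := ltOn_mex_term lt.
have [[x' lx ->]|[x' lx ->]] := ltOn_add ld.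
  by rewrite mexDl // => /addIr/mex_term_neq []; rewrite lt_eqF.
by rewrite mexDr // => /addrI/mex_term_neq []; rewrite lt_eqF.
Qed.

Lemma nim_mulDl : left_distributive nim_mul (+%R : On -> On -> On).
Proof. by move=> a b c; rewrite ![_ ⊗ c]nim_mulC nim_mulDr. Qed.

Lemma nim_mulA : associative nim_mul.
Proof.
elim/On_ind=> a IHa; elim/On_ind=> b IHb; elim/On_ind=> c IHc.
(* Both sides are abc - (a - a')(b - b')(c - c'), expanded into the seven products other than
   abc. *)
have mexA a' b' c' : a' < a -> b' < b -> c' < c ->
    mex_term a (b ⊗ c) a' (mex_term b c b' c') =
    mex_term (a ⊗ b) c (mex_term a b a' b') c'.
  move=> la lb lc; rewrite /mex_term !nim_mulDl !nim_mulDr.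
  rewrite !(IHa a') // !(IHb b') // (IHc c') // !addrA.
  by rewrite [LHS](ACl (1*2*5*3*6*4*7))%AC.
apply: On_eq_nlt => lt.
  have [d ld [c' lc e]] := ltOn_mex_term lt.
  have [a' la [b' lb ed]] := ltOn_mex_term ld.
  have e' : a ⊗ (b ⊗ c) = mex_term a (b ⊗ c) a' (mex_term b c b' c').
    by rewrite mexA // -ed.
  apply: (mex_term_neq _ _ e'); first by rewrite lt_eqF.
  by apply/eqP => /esym/mex_term_neq []; rewrite lt_eqF.
have [a' la [d ld e]] := ltOn_mex_term lt.
have [b' lb [c' lc ed]] := ltOn_mex_term ld.
move: e; rewrite ed mexA // => /mex_term_neq [];
  last by rewrite lt_eqF.
by apply/eqP => /esym/mex_term_neq []; rewrite lt_eqF.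
Qed.

Definition On_one : On := least [set x | x != On_zero].

Lemma On_oneP : On_one != On_zero /\ forall x, x < On_one -> x = On_zero.
Proof.
have [|n0 min] := @leastP [set x | x != On_zero].
  (* Any nonzero ordinal would do; [omega1] is one because the empty set is countable. *)
  exists omega1; apply/eqP => e; case: omega1P => + _; rewrite e; apply.
  rewrite (_ : [set _ | _] = set0) //.
  by apply/seteqP; split=> // x /=; rewrite On_lt0.
split=> // x; rewrite ltNge => /negP lt.
by apply/eqP; apply: contrapT => /negP /min.
Qed.

(** As 0 is the only ordinal below 1, the options of 1 ⊗ a are the 1 ⊗ a' = a' with a' < a, whose
    mex is a. *)
Lemma nim_mul1 : left_id On_one nim_mul.
Proof.
have [one_neq0 lt1] := On_oneP.
elim/On_ind=> a IH; apply: On_eq_nlt => lt.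
  have := IH _ lt; set z := On_one ⊗ a => e.
  have ne : z <> mex_term On_one a On_zero z.
    by apply: mex_term_neq; [rewrite eq_sym|rewrite lt_eqF].
  by case: ne; rewrite /mex_term !nim_mul0 add0r addr0 e.
have [x /lt1 -> [a' la]] := ltOn_mex_term lt.
rewrite /mex_term !nim_mul0 add0r addr0 IH // => e.
by rewrite e ltxx in la.
Qed.

HB.instance Definition _ := GRing.Zmodule_isComNzRing.Build On
  nim_mulA nim_mulC nim_mul1 nim_mulDl On_oneP.1.

Lemma mul_OnE (a b : On) : a ⊗ b = (a * b)%R.
Proof. by []. Qed.

Lemma ltOn1 (x : On) : x < (1%R : On) -> x = 0%R.
Proof. exact: On_oneP.2. Qed.

Lemma ltOn0 (x : On) : (x < (0%R : On)) = false.
Proof. exact: On_lt0. Qed.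

Lemma gtOn0 (x : On) : ((0%R : On) < x) = (x != 0%R).
Proof. exact: On_gt0. Qed.

Lemma ltOn_mul (z a b : On) : z < (a * b)%R ->
  exists2 a', a' < a & exists2 b', b' < b & z = (a * b - (a - a') * (b - b'))%R.
Proof.
move=> /ltOn_mex_term[a' la [b' lb ->]]; exists a' => //; exists b' => //.
by rewrite /mex_term !mul_OnE !oppOn; ring: (addOnxx (a * b)%R).
Qed.

(** If a and b are nonzero, then a ⊗ b avoids its option at (0, 0), which is 0 when a ⊗ b is 0. *)
Lemma mulOn_eq0 (a b : On) : (a * b = 0 -> (a == 0) || (b == 0))%R.
Proof.
move=> ab0; apply: contrapT => /negP; rewrite negb_or => /andP[na nb].
have : a ⊗ b <> mex_term a b 0%R 0%R by apply: mex_term_neq; rewrite eq_sym.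
by apply; rewrite /mex_term !mul_OnE ab0 !(mul0r, mulr0, addr0).
Qed.

(* The integral domain structure requires a unit predicate; no claim is made
   here about which ordinals satisfy it. *)
Definition On_unit : {pred On} := [pred a | `[< exists b : On, (b * a = 1)%R >]].

Definition On_inv (a : On) : On := xget a [set b | (b * a = 1)%R].

Lemma On_mulVx : {in On_unit, left_inverse 1%R On_inv *%R}.
Proof.
move=> a /asboolP[b ba]; rewrite /On_inv.
by case: xgetP => [_ _ //|/(_ b)/(_ ba)].
Qed.

Lemma On_unitPl (a b : On) : (b * a = 1)%R -> On_unit a.
Proof. by move=> ba; apply/asboolP; exists b. Qed.

Lemma On_inv_out : {in [predC On_unit], On_inv =1 id}.
Proof.
move=> a /asboolP na; rewrite /On_inv; case: xgetP => // b _ ba.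
by case: na; exists b.
Qed.

HB.instance Definition _ :=
  GRing.ComNzRing_hasMulInverse.Build On On_mulVx On_unitPl On_inv_out.
HB.instance Definition _ := GRing.ComUnitRing_isIntegral.Build On mulOn_eq0.

(** * Countable ordinals *)

Lemma countable_image T U (f : T -> U) (A : set T) :
  countable A -> countable (f @` A).
Proof. exact/sub_countable/card_image_le. Qed.

Lemma countable_setU T (A B : set T) :
  countable A -> countable B -> countable (A `|` B).
Proof.
move=> cA cB; rewrite -bigcup2E; apply: bigcup_countable => // -[|[|i]] _ //=.
Qed.

(** Lists of natural numbers are countably many, and they cover these polynomials through a left
    inverse [h] of a coding [f] of A. *)
Lemma countable_coefs (R : nzRingType) (A : set R) : countable A ->
  countable [set p : {poly R} | forall i, A p`_i].
Proof.
move=> /countable_injP[f f_inj].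
pose h n : R := xget 0%R [set x | A x /\ f x = n].
have fK x : A x -> h (f x) = x.
  move=> Ax; rewrite /h; case: xgetP => [y _ [Ay]|/(_ x)/(_ (conj Ax erefl)) //].
  by apply: f_inj; rewrite inE.
apply: (@sub_countable _ _ _ (range (fun l => Poly (map h l)))); last first.
  exact: countable_image.
apply: subset_card_le => p Ap; exists (map f p) => //.
rewrite -map_comp map_id_in ?polyseqK // => x /(nthP 0%R)[i _ <-] /=.
exact: fK.
Qed.

Lemma finite_roots (R : idomainType) (p : {poly R}) :
  p != 0%R -> finite_set [set x | root p x].
Proof.
move=> p0; apply: contrapT => /(@infinite_set_fset _ _ (size p))[B sB].
apply/negP; rewrite -ltnNge; apply: max_poly_roots => //.
  by apply/allP => x /sB.
exact: finmap.fset_uniq.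
Qed.

Lemma lt_omega1 (a : On) : countable [set x | x < a] -> a < omega1.
Proof.
move=> ca; rewrite ltNge; apply/negP => le_a; apply: omega1P.1.
by apply: sub_countable ca; apply: subset_card_le => x /= /lt_le_trans; apply.
Qed.

(** Uncountable cofinality of [omega1]: the ordinals that are at most some x in S form a countable
    union of countable sets, which cannot exhaust [omega1]. *)
Lemma bounded_omega1 (S : set On) : countable S ->
  (forall x, S x -> x < omega1) -> exists2 b, b < omega1 & forall x, S x -> x < b.
Proof.
move=> cS ltS.
have cU : countable (\bigcup_(x in S) [set y : On | y <= x]).
  apply: bigcup_countable => // x /ltS/omega1P.2 cx.
  rewrite (_ : [set y : On | y <= x] = [set y | y < x] `|` [set x]).
    by apply: countable_setU => //; apply: countable1.
  by apply/seteqP; split=> y /=; rewrite le_eqVlt;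
     [case/orP => [/eqP ->|]; [right|left] | case=> [->|->]; rewrite ?eqxx ?orbT].
have [b lt_b nb] : exists2 b, b < omega1 & ~ (\bigcup_(x in S) [set y | y <= x]) b.
  apply: contrapT => /forall2NP H; apply: omega1P.1.
  apply: sub_countable cU; apply: subset_card_le => x /= lx.
  by case: (H x) => [//|/contrapT].
exists b => // x Sx; rewrite ltNge; apply/negP => bx; apply: nb.
by exists x.
Qed.

(** * Initial segments that are rings *)

Record segment_ring := SegmentRing {
  bound : On;
  bound1 : (1%R : On) < bound;
  boundD : forall x y, x < bound -> y < bound -> (x + y)%R < bound;
  boundM : forall x y, x < bound -> y < bound -> (x * y)%R < bound }.

Definition segment (g : segment_ring) : {pred On} := [pred x | x < bound g].

(** Each ordinal is its own opposite, so closure under subtraction is [boundD]. *)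
Lemma segment_subring g : subring_closed (segment g).
Proof.
by split=> [|x y|x y]; [apply: bound1|apply: boundD|apply: boundM].
Qed.

HB.instance Definition _ g :=
  GRing.isSubringClosed.Build On (segment g) (segment_subring g).

Lemma omega1_bound1 : (1%R : On) < omega1.
Proof.
apply: lt_omega1; apply: (@sub_countable _ _ _ [set (0%R : On)]).
  by apply: subset_card_le => x /ltOn1.
exact: countable1.
Qed.

(** Every ordinal below x + y is an option, and countable x and y have only countably many
    options. *)
Lemma omega1_boundD (x y : On) :
  x < omega1 -> y < omega1 -> (x + y)%R < omega1.
Proof.
move=> /omega1P.2 cx /omega1P.2 cy; apply: lt_omega1.
pose A : set On := (+%R^~ y)%R @` [set z : On | z < x].
pose B : set On := (+%R x) @` [set z : On | z < y].
apply: (@sub_countable _ _ _ (A `|` B)).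
  apply: subset_card_le => z /ltOn_add[[z' lz ->]|[z' lz ->]].
    by left; exists z'.
  by right; exists z'.
by apply: countable_setU; apply: countable_image.
Qed.

Lemma omega1_boundM (x y : On) :
  x < omega1 -> y < omega1 -> (x * y)%R < omega1.
Proof.
move=> /omega1P.2 cx /omega1P.2 cy; apply: lt_omega1.
pose f (p : On * On) : On := (x * y - (x - p.1) * (y - p.2))%R.
apply: (@sub_countable _ _ _ (f @` ([set z | z < x] `*` [set z | z < y]))).
  by apply: subset_card_le => z /ltOn_mul[a la [b lb ->]]; exists (a, b).
exact/countable_image/countableX.
Qed.

Definition omega1_ring : segment_ring :=
  SegmentRing omega1_bound1 omega1_boundD omega1_boundM.

(** * Countable transcendental ordinals *)

(** Starting from a, each stage [u n.+1] is a countable bound of [u n] and [T (u n)], and g is the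
    supremum of the stages. Finitely many ordinals below g thus already lie below one stage. *)
Lemma omega1_closure (T : On -> set On) (a : On) : a < omega1 ->
    (forall d, d < omega1 -> countable (T d)) ->
    (forall d x, d < omega1 -> T d x -> x < omega1) ->
  exists (u : nat -> On) (g : On), [/\ a < g, g < omega1,
    forall x, x < g <-> exists n, x < u n,
    {homo u : m n / (m <= n)%N >-> m <= n} &
    forall n x, T (u n) x -> x < u n.+1].
Proof.
move=> a_lt cT ltT.
have step (d : On) : exists e : On, d < omega1 ->
    [/\ e < omega1, d < e & forall x, T d x -> x < e].
  case: (pselect (d < omega1)) => [d_lt|nd]; last by exists d.
  have [||e e_lt eP] := @bounded_omega1 (T d `|` [set d]).
  - by apply: countable_setU; [apply: cT|apply: countable1].
  - by move=> x [/(ltT _ _ d_lt)|->].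
  by exists e; split=> // [|x Tx]; apply: eP; [right|left].
have [f fP] := choice step; pose u n := iter n f a.
have u_lt n : u n < omega1 by elim: n => //= n /fP[].
have u_homo : {homo u : m n / (m <= n)%N >-> m <= n}.
  apply: homo_leq => // [y x z|n]; first exact: le_trans.
  by have [_ /ltW] := fP _ (u_lt n).
have [||b b_lt bP] := @bounded_omega1 (range u).
- exact: countable_image.
- by move=> _ [n _ <-].
have [|ug min_g] := @leastP [set y | forall n, u n <= y].
  by exists b => n; apply/ltW/bP; exists n.
set g := least _ in ug min_g.
exists u, g; split=> //.
- by apply: lt_le_trans (ug 1); have [] := fP _ (u_lt 0).
- by apply: le_lt_trans b_lt; apply: min_g => n; apply/ltW/bP; exists n.
- move=> x; split=> [lx|[n /lt_le_trans]]; last by apply; apply: ug.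
  apply: contrapT => /forallNP nu; move: lx; rewrite ltNge => /negP; apply.
  by apply: min_g => n; rewrite leNgt; apply/negP/nu.
- by move=> n; have [] := fP _ (u_lt n).
Qed.

(** If a nonzero polynomial over the segment vanished at its bound g, its coefficients would all lie
    below some stage [u n]; the countable roots of such polynomials lie below [u n.+1], whence g <
    g. *)
Lemma exists_transcendental_segment (a : On) : a < omega1 ->
  exists g : segment_ring, [/\ a < bound g, bound g < omega1 &
    forall p, p \is a polyOver (segment g) -> p.[bound g]%R = 0%R -> p = 0%R].
Proof.
move=> a_lt.
pose sums (d : On) : set On :=
  (fun p => p.1 + p.2)%R @` ([set x | x < d] `*` [set x | x < d]).
pose prods (d : On) : set On :=
  (fun p => p.1 * p.2)%R @` ([set x | x < d] `*` [set x | x < d]).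
pose polys (d : On) : set {poly On} :=
  [set p : {poly On} | (forall i, (p`_i : On)%R < d) /\ p != 0%R].
(* The restriction to x < [omega1] keeps the next stage countable. *)
pose roots (d : On) : set On :=
  [set x | x < omega1 /\ exists2 p, polys d p & root p x].
have [|||u [g [m_lt g_lt uP u_homo uT]]] :=
    @omega1_closure (fun d => sums d `|` prods d `|` roots d) (Order.max a (1%R : On)).
- by rewrite gt_max a_lt omega1_bound1.
- move=> d /omega1P.2 cd; apply: countable_setU.
    by apply: countable_setU; apply/countable_image/countableX.
  apply: (@sub_countable _ _ _
    (\bigcup_(p in polys d) [set x | root p x])).
    by apply: subset_card_le => x [_ [p dp rp]]; exists p.
  apply: bigcup_countable => [|p [_ p0]].
    apply: sub_countable (countable_coefs cd).
    by apply: subset_card_le => p [].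
  exact/finite_set_countable/finite_roots.
- move=> d x d_lt [[]|[]//] [[y z] [/= yd zd] <-].
    by apply: omega1_boundD; apply: lt_trans d_lt.
  by apply: omega1_boundM; apply: lt_trans d_lt.
have le_u x y : x < g -> y < g -> exists n, x < u n /\ y < u n.
  move=> /uP[m lm] /uP[n ln]; exists (maxn m n); split.
    exact/(lt_le_trans lm)/u_homo/leq_maxl.
  exact/(lt_le_trans ln)/u_homo/leq_maxr.
have gD x y : x < g -> y < g -> (x + y)%R < g.
  move=> lx ly; have [n [xn yn]] := le_u _ _ lx ly; apply/uP; exists n.+1.
  by apply: uT; left; left; exists (x, y).
have gM x y : x < g -> y < g -> (x * y)%R < g.
  move=> lx ly; have [n [xn yn]] := le_u _ _ lx ly; apply/uP; exists n.+1.
  by apply: uT; left; right; exists (x, y).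
move: m_lt; rewrite gt_max => /andP[a_g g1].
exists (SegmentRing g1 gD gM); split=> //= p /polyOverP pg /rootP rp.
apply/eqP; apply: contrapT => /negP p0.
have [n un] : exists n, forall i, (p`_i : On)%R < u n.
  have [N leN] : exists N, forall i, (i < size p)%N -> (p`_i : On)%R < u N.
    elim: (size p) => [|k [m IH]]; first by exists 0%N.
    have [n pn] := (uP _).1 (pg k).
    exists (maxn m n) => i; rewrite ltnS leq_eqVlt => /orP[/eqP ->|/IH lt].
      exact/(lt_le_trans pn)/u_homo/leq_maxr.
    exact/(lt_le_trans lt)/u_homo/leq_maxl.
  (* The coefficients beyond the size are 0, which must lie below the stage too. *)
  have : exists n, (0%R : On) < u n by apply/uP; rewrite (lt_trans _ g1) // gtOn0 oner_neq0.
  move=> [M ltM]; exists (maxn N M) => i; case: (ltnP i (size p)) => [/leN lt|le].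
    exact/(lt_le_trans lt)/u_homo/leq_maxl.
  by rewrite nth_default //; apply/(lt_le_trans ltM)/u_homo/leq_maxr.
suff: g < g by rewrite ltxx.
by apply/uP; exists n.+1; apply: uT; right; split=> //; exists p.
Qed.

(** * Polynomial equations *)

Lemma ltOn_exp (z a : On) k : z < (a ^+ k)%R ->
  exists s : seq On, [/\ size s = k, all (fun c => c < a) s &
    z = (a ^+ k - (\prod_(c <- s) ('X - c%:P)).[a])%R].
Proof.
elim: k z => [|k IH] z.
  rewrite expr0 => /ltOn1 ->; exists [::].
  by rewrite big_nil hornerC subrr.
(* By induction a ^+ k - v is the product of the a - c_i; the option of a * a ^+ k at (c, v)
   multiplies it by a - c. *)
rewrite exprS => /ltOn_mul[c lc [v /IH[s [sz als ->]] ->]].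
exists (c :: s); rewrite /= sz lc als big_cons; split=> //.
by rewrite hornerM hornerXsubC subKr.
Qed.

Lemma size_polyD_le (R : nzRingType) (p q : {poly R}) n :
  (size p <= n)%N -> (size q <= n)%N -> (size (p + q)%R <= n)%N.
Proof. by move=> lp lq; rewrite (leq_trans (size_polyD p q)) // geq_max lp. Qed.

Lemma prod_over (g : segment_ring) (s : seq On) :
  all (fun c => c < bound g) s ->
  (\prod_(c <- s) ('X - c%:P))%R \is a polyOver (segment g).
Proof.
move=> /allP als; rewrite big_seq; apply: rpred_prod => c cs.
by rewrite polyOverXsubC; apply: als.
Qed.

(** Induction on k, with p = a X^k + r. A value below p(g) lowers either a g^k, to a g^k - (a -
    a')(g - c_1)...(g - c_k) with a' < a and c_i < g, or r(g), where induction applies. *)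
Lemma polyOver_values_initial (g : segment_ring) k (p : {poly On}) (z : On) :
  p \is a polyOver (segment g) -> (size p <= k)%N -> z < p.[bound g]%R ->
  exists q, [/\ q \is a polyOver (segment g), (size q <= k)%N & z = q.[bound g]%R].
Proof.
elim: k p z => [|k IH] p z pg.
  by rewrite leqn0 size_poly_eq0 => /eqP ->; rewrite horner0 ltOn0.
move=> szp; pose a := (p`_k)%R; pose r := take_poly k p.
have ag : a \in segment g by apply: (polyOverP pg).
have rg : r \is a polyOver (segment g).
  by apply/polyOverP => i; rewrite coef_take_poly; case: ifP => _;
     [apply: (polyOverP pg)|apply: rpred0].
have szr : (size r <= k)%N by apply: size_take_poly.
have pE : p = (a *: 'X^k + r)%R.
  apply/polyP => i; rewrite coefD coefZ coefXn coef_take_poly.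
  have [lt|lt|->] := ltngtP i k; rewrite ?mulr0 ?mulr1 ?add0r ?addr0 //.
  by rewrite nth_default // (leq_trans szp).
have sz_aX b : (size (b *: 'X^k : {poly On})%R <= k.+1)%N.
  by rewrite (leq_trans (size_scale_leq _ _)) // size_polyXn.
have Xg b : b \in segment g -> (b *: 'X^k)%R \is a polyOver (segment g).
  by move=> bg; apply: polyOverZ => //; rewrite rpredX // polyOverX.
rewrite pE hornerD hornerZ hornerXn => /ltOn_add[[u lu ->]|[e /IH]].
  have [a' la [v /ltOn_exp[s [szs als ->]] ->]] := ltOn_mul lu.
  exists (a *: 'X^k - (a - a') *: \prod_(c <- s) ('X - c%:P) + r)%R.
  have a'g : a' \in segment g by apply: lt_trans ag.
  split.
  - by rewrite !rpredD ?rpredN ?Xg // polyOverZ ?rpredB ?prod_over.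
  - apply: size_polyD_le; last exact: leqW.
    apply: size_polyD_le => //; rewrite size_polyN.
    by rewrite (leq_trans (size_scale_leq _ _)) // size_prod_XsubC szs.
  - by rewrite subKr !hornerE.
move=> /(_ rg szr)[q [qg szq ->]]; exists (a *: 'X^k + q)%R; split.
- by rewrite rpredD ?Xg.
- by apply: size_polyD_le => //; apply: leqW.
- by rewrite !hornerE.
Qed.

(** Let g be transcendental over a segment ring containing a. Then ag is neither 0 nor 1, so 1 < ag
    and 1 = ag - (a - a')(g - c). The coefficient of g on the right is a', hence a' = 0 and 1 =
    ac. *)
Lemma omega1_inv (a : On) : a < omega1 -> a != 0%R ->
  exists2 b, b < omega1 & (b * a = 1)%R.
Proof.
move=> a_lt a0; have [g [ag g_lt transc]] := exists_transcendental_segment a_lt.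
have lin b c : b \in segment g -> c \in segment g ->
    (b * bound g = c)%R -> b = 0%R.
  move=> bg cg e; have p0 : (b *: 'X - c%:P = 0 :> {poly On})%R.
    apply: transc; last by rewrite !hornerE e subrr.
    by rewrite rpredB ?polyOverC // polyOverZ // polyOverX.
  have := congr1 (fun p : {poly On} => p`_1)%R p0.
  by rewrite coefB coefZ coefX coefC mulr1 subr0 coef0.
have g1 : (1 : On)%R \in segment g := rpred1 _.
case: (ltgtP (a * bound g)%R 1%R) => [/ltOn1/lin|lt|/lin]; last 1 first.
- by move=> /(_ ag g1)/eqP; rewrite (negPf a0).
- by move=> /(_ ag (rpred0 _))/eqP; rewrite (negPf a0).
have [a' la [c lc e]] := ltOn_mul lt.
have a'g : a' \in segment g by apply: lt_trans ag.
have a'0 : a' = 0%R.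
  apply: (lin _ (1 - a * c + a' * c)%R) => //.
    by rewrite rpredD ?rpredB ?rpredM.
  by rewrite e; ring.
exists c; first exact: lt_trans g_lt.
by rewrite [RHS]e a'0; ring.
Qed.

Lemma omega1_root (n : nat) (P : nat -> On) : (0 < n)%N ->
    (forall i, P i < omega1) ->
  exists2 x, x < omega1 & (x ^+ n = \sum_(i < n) P i * x ^+ i)%R.
Proof.
move=> n0 P_lt.
have [||a a_lt aP] := @bounded_omega1 (range P).
- exact: countable_image.
- by move=> _ [i _ <-].
have [g [ag g_lt transc]] := exists_transcendental_segment a_lt.
pose q := (\poly_(i < n) P i)%R.
have qE x : (q.[x] = \sum_(i < n) P i * x ^+ i)%R by apply: horner_poly.
have qg : q \is a polyOver (segment g).
  apply/polyOverP => i; rewrite coef_poly; case: ifP => _; last exact: rpred0.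
  by apply: lt_trans ag; apply: aP; exists i.
have szq : (size q <= n)%N by apply: size_poly.
(* X^n - r is nonzero: its coefficient at n is 1. *)
have transcX r : r \is a polyOver (segment g) -> (size r <= n)%N ->
    (bound g ^+ n)%R <> (r.[bound g])%R.
  move=> rg szr e; have p0 : ('X^n - r = 0 :> {poly On})%R.
    apply: transc; last by rewrite !hornerE e subrr.
    by rewrite rpredB // rpredX // polyOverX.
  have := congr1 (fun p : {poly On} => p`_n)%R p0.
  rewrite coefB coefXn eqxx coef0 nth_default // subr0.
  by apply/eqP/oner_neq0.
case: (ltgtP (bound g ^+ n)%R q.[bound g]%R) => [lt|/ltOn_exp[s [szs als e]]|].
- have [r [rg szr /transcX[]//]] := polyOver_values_initial qg szq lt.
- have qs : ('X^n - q = \prod_(c <- s) ('X - c%:P))%R.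
    apply/eqP; rewrite -subr_eq0; apply/eqP/transc.
      by rewrite !rpredB ?prod_over // rpredX // polyOverX.
    by rewrite 2!hornerD !hornerN hornerXn e subKr subrr.
  (* As n > 0 there is at least one linear factor, and it provides the root. *)
  case: s szs als qs {e} => [n0'|c s _ /andP[cg _] qs]; first by rewrite -n0' in n0.
  exists c; first exact: lt_trans g_lt.
  rewrite -qE; apply/eqP; rewrite -subr_eq0.
  have <- : (('X^n - q).[c] = c ^+ n - q.[c])%R by rewrite !hornerE.
  by rewrite qs big_cons hornerM hornerXsubC subrr mul0r.
- by move/(transcX _ qg szq).
Qed.

(** * The field of countable ordinals *)

Definition countable_On : Type := {x : On | x \in segment omega1_ring}.

HB.instance Definition _ := SubChoice.on countable_On.
HB.instance Definition _ := [SubChoice_isSubComNzRing of countable_On by <:].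

(** Both clauses stand together so that a single choice gives an inverse function with value 0 at 0,
    as the field structure demands. *)
Lemma countable_On_inv (x : countable_On) :
  exists y : countable_On, (x != 0 -> y * x = 1)%R /\ (x = 0 -> y = 0)%R.
Proof.
case: (eqVneq x 0%R) => [->|x0]; first by exists 0%R.
have [b b_lt bx] := omega1_inv (valP x) x0.
exists (Sub b b_lt); split=> [_|e]; first exact: val_inj.
by rewrite e eqxx in x0.
Qed.

Definition countable_inv (x : countable_On) := sval (cid (countable_On_inv x)).

Lemma countable_mulVf (x : countable_On) :
  x != 0%R -> (countable_inv x * x = 1)%R.
Proof. by move=> x0; have [+ _] := svalP (cid (countable_On_inv x)); apply. Qed.

Lemma countable_inv0 : countable_inv 0%R = 0%R.
Proof. by have [_] := svalP (cid (countable_On_inv 0%R)); apply. Qed.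

HB.instance Definition _ :=
  GRing.ComNzRing_isField.Build countable_On countable_mulVf countable_inv0.

Lemma countable_On_closed : GRing.closed_field_axiom countable_On.
Proof.
move=> n P n0.
have [||x x_lt xP] := @omega1_root n (val \o P); first by [].
  by move=> i; apply: (valP (P i)).
(* The equation is carried to [On] along the inclusion, a ring morphism. *)
pose v : {rmorphism countable_On -> On} := \val.
exists (Sub x x_lt); apply: val_inj; rewrite -![\val _]/(v _).
rewrite rmorphXn rmorph_sum [LHS]xP; apply: eq_bigr => i _.
by rewrite rmorphM rmorphXn.
Qed.

HB.instance Definition _ := Field_isAlgClosed.Build countable_On countable_On_closed.

Theorem proposition3p6 : transcendental omega1.
Proof.
exists countable_On, \val; split=> //.
apply/seteqP; split=> [_ [x _ <-]|x x_lt]; first exact: (valP x).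
by exists (Sub x x_lt).
Qed.
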